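(* Let $\mathcal C$ be a Cartan scheme of rank three with $I=\{1,2,3\}$ such that $\mathcal R^{\mathrm{re}}(\mathcal C)$ is a finite irreducible root system of type $\mathcal C$. Let $a\in A$ and $\gamma_1,\gamma_2,\alpha\in R^a$. Assume that $\{\gamma_1,\gamma_2\}$ is a base for $V^a(\gamma_1,\gamma_2)$ at $a$ and that $\mathrm{Vol}_3(\gamma_1,\gamma_2,\alpha)=1$. Then either $\{\gamma_1,\gamma_2,\alpha\}$ is a base for $\mathbb Z^I$ at $a$, or one of $\alpha-\gamma_1$, $\alpha-\gamma_2$ is contained in $R^a$.
   Context: Notation: $\mathbb N=\{1,2,3,\dots\}$, $\mathbb N_0=\mathbb N\cup\{0\}$. Let $I$ be a non-empty finite set and $\{\alpha_i\mid i\in I\}$ the standard basis of $\mathbb Z^I$ (the $\alpha_i$ are the simple roots). A generalized Cartan matrix is $C=(c_{ij})_{i,j\in I}\in\mathbb Z^{I\times I}$ with $c_{ii}=2$, $c_{jk}\le 0$ for $j\ne k$, and $c_{ij}=0\Rightarrow c_{ji}=0$. A Cartan scheme $\mathcal C=\mathcal C(I,A,(\rho_i)_{i\in I},(C^a)_{a\in A})$ consists of a non-empty set $A$ (the objects), maps $\rho_i:A\to A$ ($i\in I$), and generalized Cartan matrices $C^a=(c^a_{jk})_{j,k\in I}$ ($a\in A$) such that $\rho_i^2=\mathrm{id}$ and $c^a_{ij}=c^{\rho_i(a)}_{ij}$ for all $a\in A$, $i,j\in I$. Its rank is $\#I$. Define $\sigma_i^a\in\mathrm{Aut}(\mathbb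 Z^I)$ by $\sigma_i^a(\alpha_j)=\alpha_j-c^a_{ij}\alpha_i$ for all $j\in I$. The Weyl groupoid $\mathcal W(\mathcal C)$ is the category with object set $A$ whose morphisms are the compositions of the maps $\sigma_i^a$, where $\sigma_i^a$ is regarded as an element of $\mathrm{Hom}(a,\rho_i(a))$; so each $w\in\mathrm{Hom}(a,b)$ is an automorphism of $\mathbb Z^I$. The set of real roots at $a$ is $R^a=\{w(\alpha_j)\mid b\in A,\ w\in\mathrm{Hom}(b,a),\ j\in I\}$, and $R^a_+=R^a\cap\mathbb N_0^I$. Put $m^a_{i,j}=\#(R^a\cap(\mathbb N_0\alpha_i+\mathbb N_0\alpha_j))$. The pair $\mathcal R^{\mathrm{re}}(\mathcal C)=(\mathcal C,(R^a)_{a\in A})$ is called a root system of type $\mathcal C$ if for all $a\in A$ and $i,j\in I$: (R1) $R^a=R^a_+\cup -R^a_+$; (R2) $R^a\cap\mathbb Z\alpha_i=\{\alpha_i,-\alpha_i\}$; (R3) $\sigma_i^a(R^a)=R^{\rho_i(a)}$; (R4) if $i\ne j$ and $m^a_{i,j}$ is finite then $(\rho_i\rho_j)^{m^a_{i,j}}(a)=a$. It is finite if $R^a$ is finite for all $a\in A$. A finite root system $\mathcal R^{\mathrm{re}}(\mathcal C)$ of type $\mathcal C$ is irreducible if and only if the matrix $C^a$ is indecomposable for every $a\in A$ (this may be taken as the definition). For linearly independent $\beta_1,\dots,\beta_k\in R^a$, $V^a(\beta_1,\dots,\beta_k)$ is the unique maximal subgroup of $\mathbb Z^I$ of rank $k$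 containing $\beta_1,\dots,\beta_k$ (i.e. the intersection of $\mathbb Z^I$ with their rational span). If $W\subseteq\mathbb Z^I$ is a subgroup of rank $k$ with $\mathbb Z^I/W$ free, then $\{\beta_1,\dots,\beta_k\}$ is a base for $W$ at $a$ if $\beta_i\in W$ for all $i$ and $W\cap R^a\subseteq\sum_{i=1}^k\mathbb N_0\beta_i\cup-\sum_{i=1}^k\mathbb N_0\beta_i$. For $\beta_1,\beta_2,\beta_3\in\mathbb Z^3$, $\mathrm{Vol}_3(\beta_1,\beta_2,\beta_3)$ is the absolute value of the determinant of the matrix with columns $\beta_1,\beta_2,\beta_3$. *)

(* Defs.v *)
From HB Require Import structures.
From mathcomp Require Import all_boot all_order all_algebra.
From mathcomp Require Import boolp classical_sets functions cardinality.

Set Implicit Arguments.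
Unset Strict Implicit.
Unset Printing Implicit Defensive.

Import Order.TTheory GRing.Theory Num.Theory.

Local Open Scope classical_set_scope.
Local Open Scope card_scope.
Local Open Scope ring_scope.

(* The index set I is 'I_n, and Z^I is the type 'cV[int]_n of integer columns;
   automorphisms of Z^I are integer matrices acting by left multiplication. *)

Definition simple_root (n : nat) (i : 'I_n) : 'cV[int]_n := delta_mx i 0.

Definition generalized_cartan (n : nat) (M : 'M[int]_n) : Prop :=
  [/\ forall i, M i i = 2,
      forall j k, j != k -> M j k <= 0 &
      forall i j, M i j = 0 -> M j i = 0].

Definition decomposable (n : nat) (M : 'M[int]_n) : Prop :=
  exists J : {set 'I_n},
    [/\ exists i, i \in J,
        exists i, i \notin J &
        forall j k, j \in J -> k \notin J -> M j k = 0 /\ M k j = 0].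

Definition indecomposable (n : nat) (M : 'M[int]_n) : Prop := ~ decomposable M.

Record cartan_scheme (n : nat) := CartanScheme {
  obj :> Type;
  rho : 'I_n -> obj -> obj;
  cartan : obj -> 'M[int]_n;
  rank_gt0 : (0 < n)%N;
  obj_inhabited : inhabited obj;
  cartan_gcm : forall a, generalized_cartan (cartan a);
  rhoK : forall i, involutive (rho i);
  cartan_rho : forall a i j, cartan a i j = cartan (rho i a) i j
}.

Arguments rho {n c} i a : rename.
Arguments cartan {n c} a : rename.

(* Column j is the image of the j-th simple root; see sigma_simple below. *)
Definition sigma (n : nat) (C : cartan_scheme n) (i : 'I_n) (a : C) : 'M[int]_n :=
  \matrix_(k, j) (simple_root j - cartan a i j *: simple_root i) k 0.

Lemma sigma_simple (n : nat) (C : cartan_scheme n) (i : 'I_n) (a : C) (j : 'I_n) :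
  sigma i a *m simple_root j = simple_root j - cartan a i j *: simple_root i.
Proof.
rewrite /simple_root -colE; apply/matrixP => k l.
by rewrite (ord1 l) mxE [LHS]mxE.
Qed.

(* weyl_hom a b w : w is a morphism from a to b in the Weyl groupoid. *)
Inductive weyl_hom (n : nat) (C : cartan_scheme n) :
    C -> C -> 'M[int]_n -> Prop :=
| weyl_hom_id (a : C) : weyl_hom a a 1%:M
| weyl_hom_sigma (a b : C) (w : 'M[int]_n) (i : 'I_n) :
    weyl_hom a b w -> weyl_hom a (rho i b) (sigma i b *m w).

Definition real_roots (n : nat) (C : cartan_scheme n) (a : C) : set 'cV[int]_n :=
  [set v | exists (b : C) (w : 'M[int]_n) (j : 'I_n),
             weyl_hom b a w /\ v = w *m simple_root j].

Definition nonneg_vectors (n : nat) : set 'cV[int]_n :=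
  [set v | forall i, 0 <= v i 0].

Definition nat_span (n k : nat) (beta : k.-tuple 'cV[int]_n) : set 'cV[int]_n :=
  [set v | exists c : 'I_k -> nat, v = \sum_(i < k) tnth beta i *+ c i].

Definition opp_set (n : nat) (X : set 'cV[int]_n) : set 'cV[int]_n :=
  [set - v | v in X].

(* In (R4), the hypothesis on m says that the set defining m^a_{i,j} is finite
   with exactly m elements, where `I_m is the set of naturals below m. *)
Definition is_root_system (n : nat) (C : cartan_scheme n)
    (R : C -> set 'cV[int]_n) : Prop :=
  forall a : C,
  [/\ R a = (R a `&` @nonneg_vectors n) `|` opp_set (R a `&` @nonneg_vectors n),
      forall i, R a `&` [set z *: simple_root i | z in [set: int]]
                = [set simple_root i; - simple_root i],
      forall i, [set sigma i a *m v | v in R a] = R (rho i a) &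
      forall (i j : 'I_n) (m : nat), i != j ->
        R a `&` nat_span [tuple simple_root i; simple_root j] #= `I_m ->
        iter m (fun b => rho i (rho j b)) a = a].

Definition is_finite_root_system (n : nat) (C : cartan_scheme n)
    (R : C -> set 'cV[int]_n) : Prop :=
  is_root_system R /\ forall a : C, finite_set (R a).

Definition is_finite_irreducible_root_system (n : nat) (C : cartan_scheme n)
    (R : C -> set 'cV[int]_n) : Prop :=
  is_finite_root_system R /\ forall a : C, indecomposable (cartan a).

(* V(beta): the integer vectors in the rational span of beta. *)
Definition saturated_span (n k : nat) (beta : k.-tuple 'cV[int]_n) :
    set 'cV[int]_n :=
  [set v | exists q : 'I_k -> rat,
     map_mx intr v = \sum_(i < k) q i *: map_mx intr (tnth beta i)].

(* Meant for a subgroup W of rank k with free quotient, which is the case for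
   saturated_span of k independent vectors, and for setT when k = n. *)
Definition is_base (n : nat) (C : cartan_scheme n) (a : C) (k : nat)
    (W : set 'cV[int]_n) (beta : k.-tuple 'cV[int]_n) : Prop :=
  (forall i, W (tnth beta i)) /\
  W `&` real_roots a `<=` nat_span beta `|` opp_set (nat_span beta).

Definition vol3 (b1 b2 b3 : 'cV[int]_3) : int :=
  `| \det (\matrix_(i < 3, j < 3) tnth [tuple b1; b2; b3] j i 0) |.

(* Main.v *)
(* Pair Z^3 with integer functionals. For a functional phi vanishing at no
   root, reflecting a chamber of the Weyl groupoid in a wall with phi < 0
   lowers the number of roots separating it from phi, so some chamber has
   all its wall roots phi-positive; a root with phi = 1 must then be one of
   these walls. Let g1, g2, g3 be dual to gamma1, gamma2, alpha. If alpha -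
   gamma2 is not a root, the functional N g1 + g2 + g3 (N large) yields a
   chamber with walls gamma2 and alpha on which gamma1 >= 0. From there,
   walk towards phi = N g3 + g1 + g2 while keeping alpha as a wall: whenever
   a wall is phi-negative, walk inside the rank two residue of this wall and
   alpha. If alpha stops being a wall, then alpha = m p + n q with
   phi-positive roots p, q and m, n >= 1; comparing values of g3, one of
   them, say p, lies in the plane of gamma1 and gamma2, and n = 1. The base
   hypothesis and gamma1, gamma2 >= 0 on the chamber force p to be gamma1 or
   gamma2, and then alpha - gamma1 or alpha - gamma2 is a root because root
   strings have no gaps. Otherwise the walk ends at a chamber with walls
   gamma1, gamma2, alpha. *)
Require Import Defs.
From mathcomp Require Import all_boot all_order all_algebra.
From mathcomp Require Import boolp classical_sets functions cardinality.
From mathcomp Require Import zify.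

Set Implicit Arguments.
Unset Strict Implicit.
Unset Printing Implicit Defensive.

Import Order.TTheory GRing.Theory Num.Theory.

Local Open Scope classical_set_scope.
Local Open Scope ring_scope.

(** * Reflections and morphisms of the Weyl groupoid as integer matrices *)

Section Chambers.
Context {n : nat} {C : cartan_scheme n}.
Implicit Types (a b c : C) (w : 'M[int]_n) (v : 'cV[int]_n) (phi psi : 'rV[int]_n).

Lemma sigmaE i b k l :
  sigma i b k l = (k == l)%:R - cartan b i l * (k == i)%:R.
Proof. by rewrite /sigma /simple_root !mxE eqxx !andbT. Qed.

Lemma sigma_coord i b v k : k != i -> (sigma i b *m v) k 0 = v k 0.
Proof.
move=> ki; rewrite mxE (bigD1 k) //= sigmaE eqxx (negPf ki) mulr0 subr0 mul1r.
rewrite big1 ?addr0 // => l lk.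
by rewrite sigmaE eq_sym (negPf lk) (negPf ki) mulr0 subr0 mul0r.
Qed.

Lemma sigma_simple_self i b :
  sigma i b *m simple_root i = - simple_root i.
Proof.
have [h _ _] := cartan_gcm b.
by rewrite sigma_simple h -[X in X - _]scale1r -scalerBl -scaleN1r.
Qed.

Lemma matrix_eq_simple (u w : 'M[int]_n) :
  (forall j, u *m simple_root j = w *m simple_root j) -> u = w.
Proof.
move=> h; apply/matrixP => k j; have /matrixP/(_ k 0) := h j.
by rewrite -!colE !mxE.
Qed.

Lemma sigmaK i b : sigma i b *m sigma i b = 1%:M.
Proof.
apply: matrix_eq_simple => j.
rewrite -mulmxA sigma_simple mulmxBr -scalemxAr sigma_simple sigma_simple_self.
by rewrite scalerN opprK subrK mul1mx.
Qed.

Lemma sigma_rho i b : sigma i (rho i b) = sigma i b.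
Proof. by apply/matrixP => k l; rewrite !sigmaE -cartan_rho. Qed.

Lemma weyl_hom_comp a b c (u w : 'M[int]_n) :
  weyl_hom a b u -> weyl_hom b c w -> weyl_hom a c (w *m u).
Proof.
move=> hu hw; elim: hw u hu => [d|d e w' i _ IH] u hu; first by rewrite mul1mx.
by rewrite -mulmxA; apply: weyl_hom_sigma; apply: IH.
Qed.

(** The reflection has the same matrix at [b] and at [rho i b], and [rho i] is an involution, so
    this matrix also leads back. *)
Lemma weyl_hom_refl i b : weyl_hom (rho i b) b (sigma i b).
Proof.
have := weyl_hom_sigma i (weyl_hom_id (rho i b)).
by rewrite rhoK mulmx1 sigma_rho.
Qed.

Lemma weyl_hom_inv a b (u : 'M[int]_n) :
  weyl_hom a b u -> exists2 u', weyl_hom b a u' & u' *m u = 1%:M.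
Proof.
elim=> [d|d e w i _ [w' hw' w'w]].
  by exists 1%:M; [exact: weyl_hom_id | rewrite mul1mx].
exists (w' *m sigma i e); first exact: weyl_hom_comp (weyl_hom_refl _ _) hw'.
by rewrite -mulmxA (mulmxA (sigma i e)) sigmaK mul1mx.
Qed.

Lemma weyl_hom_unitmx a b (u : 'M[int]_n) : weyl_hom a b u -> u \in unitmx.
Proof. by case/weyl_hom_inv => u' _ /mulmx1_unit []. Qed.

(** * Weyl chambers and coordinates with respect to their wall roots *)

(* The columns of [w] are the roots of the walls of a Weyl chamber at [a]. *)
Definition chamber a w := exists b, weyl_hom b a w.

Definition coord w v : 'cV[int]_n := invmx w *m v.

(** For a root [v], the chamber lies on the nonnegative side of the hyperplane of [v]. *)
Definition nonneg_on w v := [forall i, 0 <= coord w v i 0].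

Definition ev phi v : int := (phi *m v) 0 0.

Lemma evD phi u v : ev phi (u + v) = ev phi u + ev phi v.
Proof. by rewrite /ev mulmxDr mxE. Qed.

Lemma evN phi v : ev phi (- v) = - ev phi v.
Proof. by rewrite /ev mulmxN mxE. Qed.

Lemma evZ phi k v : ev phi (k *: v) = k * ev phi v.
Proof. by rewrite /ev -scalemxAr mxE. Qed.

Lemma ev_sum phi (I : finType) (F : I -> 'cV[int]_n) :
  ev phi (\sum_i F i) = \sum_i ev phi (F i).
Proof. by rewrite /ev mulmx_sumr summxE. Qed.

Lemma evDl phi psi v : ev (phi + psi) v = ev phi v + ev psi v.
Proof. by rewrite /ev mulmxDl mxE. Qed.

Lemma evZl k phi v : ev (k *: phi) v = k * ev phi v.
Proof. by rewrite /ev -scalemxAl mxE. Qed.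

Lemma chamber_unitmx a w : chamber a w -> w \in unitmx.
Proof. by case=> b /weyl_hom_unitmx. Qed.

Lemma chamber_root a w j : chamber a w -> real_roots a (w *m simple_root j).
Proof. by case=> b hw; exists b, w, j. Qed.

Lemma coord_simple w j : w \in unitmx -> coord w (w *m simple_root j) = simple_root j.
Proof. by move=> hw; rewrite /coord mulmxA mulVmx // mul1mx. Qed.

Lemma coordE w v : w \in unitmx -> v = \sum_j coord w v j 0 *: (w *m simple_root j).
Proof.
move=> hw; under eq_bigr do rewrite scalemxAr; rewrite -mulmx_sumr.
suff <- : coord w v = \sum_i coord w v i 0 *: simple_root i by rewrite mulKVmx.
by rewrite [LHS]matrix_sum_delta; apply: eq_bigr => i _; rewrite big_ord1.
Qed.

Lemma coordD w u v : coord w (u + v) = coord w u + coord w v.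
Proof. by rewrite /coord mulmxDr. Qed.

Lemma coordZ w k v : coord w (k *: v) = k *: coord w v.
Proof. by rewrite /coord -scalemxAr. Qed.

Lemma coordDE w u v i : coord w (u + v) i 0 = coord w u i 0 + coord w v i 0.
Proof. by rewrite coordD mxE. Qed.

Lemma coordZE w k v i : coord w (k *: v) i 0 = k * coord w v i 0.
Proof. by rewrite coordZ mxE. Qed.

(** The adjacent chamber is [w *m sigma j b]. As [sigma j b] is its own inverse, coordinates are
    transformed by [sigma j b], which alters only entry [j]. *)
Lemma chamber_reflect a w j : chamber a w -> exists w',
  [/\ chamber a w', w' *m simple_root j = - (w *m simple_root j) &
      forall v i, i != j -> coord w' v i 0 = coord w v i 0].
Proof.
move=> [b hw]; exists (w *m sigma j b); split.
- by exists (rho j b); exact: weyl_hom_comp (weyl_hom_refl j b) hw.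
- by rewrite -mulmxA sigma_simple_self mulmxN.
- move=> v i ij; have hw1 := weyl_hom_unitmx hw.
  have hs := weyl_hom_unitmx (weyl_hom_refl j b).
  suff -> : coord (w *m sigma j b) v = sigma j b *m coord w v by exact: sigma_coord.
  have hsw : w *m sigma j b \in unitmx by rewrite unitmx_mul hw1.
  apply: (can_inj (mulKmx hsw)); rewrite mulKVmx //.
  by rewrite -mulmxA (mulmxA (sigma _ _)) sigmaK mul1mx mulKVmx.
Qed.

(** Roots are primitive vectors: a root is a column of an invertible integer matrix, so in suitable
    coordinates it has an entry 1, which [k] divides. *)
Lemma root_scale_unit a v u k : real_roots a v -> v = k *: u -> k = 1 \/ k = -1.
Proof.
move=> [b [w [j [hw ->]]]] e; have hu := weyl_hom_unitmx hw.
have /matrixP/(_ j 0) := coord_simple j hu.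
rewrite e coordZ [LHS]mxE [RHS]mxE !eqxx /= => h.
have : (k %| 1)%Z by rewrite -[1%Z]h dvdz_mulr.
by rewrite dvdz1; lia.
Qed.

(** The inverse of [w] carries the root to a root at the source object of [w], where (R1) decides
    the sign. *)
Lemma coord_root a w v : is_root_system (@real_roots n C) -> chamber a w ->
  real_roots a v -> nonneg_on w v \/ nonneg_on w (- v).
Proof.
move=> hR [b hw] [c [u [j [hu ->]]]].
have [w' hw' w'w] := weyl_hom_inv hw.
have hw1 := weyl_hom_unitmx hw.
have invw : invmx w = w' by rewrite -[LHS]mul1mx -w'w mulmxK.
have : real_roots b (coord w (u *m simple_root j)).
  exists c, (w' *m u), j; split; first exact: weyl_hom_comp hu hw'.
  by rewrite /coord invw mulmxA.
have [-> _ _ _] := hR b; case=> [[_ h]|[x [_ h] e]]; [left|right]; apply/forallP => i.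
  exact: h.
by rewrite /coord mulmxN -/(coord _ _) -e opprK.
Qed.

Lemma real_rootN a v : is_root_system (@real_roots n C) ->
  real_roots a v -> real_roots a (- v).
Proof.
move=> hR; have [-> _ _ _] := hR a; case=> [h|[x h <-]]; last by rewrite opprK; left.
by right; exists v.
Qed.

Lemma real_root_neq0 a v : real_roots a v -> v != 0.
Proof.
move=> hv; apply/eqP => v0; rewrite v0 in hv.
by case: (@root_scale_unit a 0 0 0 hv); rewrite ?scaler0.
Qed.

Lemma ev_coord phi w v : w \in unitmx ->
  ev phi v = \sum_j coord w v j 0 * ev phi (w *m simple_root j).
Proof. by move=> hw; rewrite {1}(coordE v hw) ev_sum; under eq_bigr do rewrite evZ. Qed.

Lemma ev_nonneg phi w v : w \in unitmx -> nonneg_on w v ->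
  (forall j, 0 < ev phi (w *m simple_root j)) -> 0 <= ev phi v.
Proof.
move=> hw /forallP hv h; rewrite (ev_coord _ _ hw).
by apply: sumr_ge0 => j _; rewrite mulr_ge0 // ltW.
Qed.

Lemma root_nonneg_on a w v phi : is_root_system (@real_roots n C) -> chamber a w ->
  real_roots a v -> (forall j, 0 < ev phi (w *m simple_root j)) -> 0 < ev phi v ->
  nonneg_on w v.
Proof.
move=> hR hw rv h hv; case: (coord_root hR hw rv) => // hN.
have := ev_nonneg (chamber_unitmx hw) hN h; rewrite evN; lia.
Qed.

(** The value 1 is a sum of nonnegative coordinates times positive integers, so a single coordinate
    is nonzero, and it equals 1. *)
Lemma ev1_column a w v phi : is_root_system (@real_roots n C) -> chamber a w ->
  real_roots a v -> (forall j, 0 < ev phi (w *m simple_root j)) -> ev phi v = 1 ->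
  exists j, v = w *m simple_root j.
Proof.
move=> hR hw rv h v1; have hu := chamber_unitmx hw.
have /forallP hv : nonneg_on w v by apply: (root_nonneg_on hR hw rv h); rewrite v1.
have [j vj] : exists j, coord w v j 0 != 0.
  apply: contrapT => /forallNP h0; have := real_root_neq0 rv.
  rewrite (coordE v hu) big1 ?eqxx // => j _.
  by have /negP/negPn/eqP -> := h0 j; rewrite scale0r.
exists j; move: v1; rewrite (ev_coord _ _ hu) (bigD1 j) //= => v1.
have s0 : 0 <= \sum_(i < n | i != j) coord w v i 0 * ev phi (w *m simple_root i).
  by apply: sumr_ge0 => i _; rewrite mulr_ge0 // ltW.
have hj : 1 <= coord w v j 0 * ev phi (w *m simple_root j).
  by have := h j; have := hv j; nia.
have /eqP s1 : \sum_(i < n | i != j) coord w v i 0 * ev phi (w *m simple_root i) = 0.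
  by move: s0 hj v1; move: (\sum_(_ < n | _) _) (_ * _) => S P; lia.
have vi i : i != j -> coord w v i 0 = 0.
  move=> ij; move: s1; rewrite psumr_eq0 => [/allP/(_ i)|k _].
    rewrite mem_index_enum ij => /(_ isT)/=; rewrite mulf_eq0 => /orP[/eqP //|/eqP e].
    by have := h i; rewrite e ltxx.
  by rewrite mulr_ge0 // ltW.
have {}vj : coord w v j 0 = 1.
  move/eqP: s1 v1 => ->; rewrite addr0; move: (hv j) (h j).
  by move: (coord _ _ _ _) (ev _ _) => x y; nia.
rewrite [LHS](coordE v hu) (bigD1 j) //= vj scale1r big1 ?addr0 // => i ij.
by rewrite vi // scale0r.
Qed.

(** * Walking through adjacent chambers towards a functional *)

(* The number of walls in [s] between [w] and the chamber where [phi] > 0. *)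
Definition dist phi w (s : seq 'cV[int]_n) :=
  count (fun v => (ev phi v < 0) && nonneg_on w v) s.

Lemma count_lt (T : eqType) (p q : pred T) (s : seq T) x :
  {in s, subpred p q} -> x \in s -> q x -> ~~ p x -> (count p s < count q s)%N.
Proof.
move=> pq xs qx px; rewrite -!size_filter.
have -> : filter p s = filter p (filter q s).
  rewrite -filter_predI; apply: eq_in_filter => y ys /=.
  by case py: (p y) => //; rewrite (pq y ys py).
rewrite size_filter ltn_neqAle count_size andbT -all_count.
by apply: contra px => /allP -> //; rewrite mem_filter qx.
Qed.

Lemma coordN w v : coord w (- v) = - coord w v.
Proof. by rewrite /coord mulmxN. Qed.

(** If the sign of [v] changes, the coordinates other than [j], common to both chambers, are both
    nonnegative and nonpositive, hence zero. *)
Lemma nonneg_on_adjacent a w w' v j : is_root_system (@real_roots n C) ->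
  chamber a w -> chamber a w' ->
  (forall i, i != j -> coord w' v i 0 = coord w v i 0) ->
  real_roots a v -> nonneg_on w v ->
  nonneg_on w' v \/ exists2 x, 0 <= x & v = x *: (w *m simple_root j).
Proof.
move=> hR hw hw' ww' rv /forallP hv; case: (coord_root hR hw' rv); first by left.
move=> /forallP hN; right; exists (coord w v j 0) => //.
rewrite [LHS](coordE v (chamber_unitmx hw)) (bigD1 j) //= big1 ?addr0 // => i ij.
have := hv i; have := hN i; rewrite coordN mxE (ww' i ij) oppr_ge0 => h1 h2.
suff /eqP -> : coord w v i 0 == 0 by rewrite scale0r.
by rewrite eq_le h1 h2.
Qed.

(** Only multiples of the wall root change sign. That root is counted in [dist] for [w] but not for
    [w'], and no root becomes newly counted. *)
Lemma reflect_closer a w phi (s : seq 'cV[int]_n) j :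
  is_root_system (@real_roots n C) -> real_roots a = [set` s] ->
  chamber a w -> ev phi (w *m simple_root j) < 0 ->
  exists w', [/\ chamber a w',
    forall v i, i != j -> coord w' v i 0 = coord w v i 0,
    forall v, real_roots a v -> 0 < ev phi v -> nonneg_on w v -> nonneg_on w' v &
    (dist phi w' s < dist phi w s)%N].
Proof.
move=> hR hs hw hj; have hu := chamber_unitmx hw.
have [w' [hw' w'j ww']] := chamber_reflect j hw; exists w'; split => //.
  move=> v rv fv hv.
  case: (nonneg_on_adjacent hR hw hw' (ww' v) rv hv) => // -[x x0 vx].
  by move: fv; rewrite vx evZ; move: (ev _ _) hj => y; nia.
apply: (@count_lt _ _ _ _ (w *m simple_root j)) => /=.
- move=> v vs /andP[fv hv]; rewrite fv /=.
  have rv : real_roots a v by rewrite hs.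
  have w'w i : i != j -> coord w v i 0 = coord w' v i 0 by move=> /ww' ->.
  case: (nonneg_on_adjacent hR hw' hw w'w rv hv) => // -[x x0 vx].
  by move: fv; rewrite vx w'j evZ evN; move: (ev _ _) hj => y; nia.
- by have := chamber_root j hw; rewrite hs.
- rewrite hj; apply/forallP => i; rewrite coord_simple // mxE.
  by case: (_ && _).
- rewrite hj /=; apply/negP => /forallP/(_ j).
  rewrite -[w *m _]opprK -w'j coordN coord_simple ?(chamber_unitmx hw') //.
  by rewrite !mxE !eqxx.
Qed.

(** Reflections are made only in walls indexed by [J], so the coordinates outside [J] never change;
    [dist] bounds the number of reflections. *)
Lemma residue_chamber a w phi (s : seq 'cV[int]_n) (J : {set 'I_n}) :
  is_root_system (@real_roots n C) -> real_roots a = [set` s] ->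
  (forall v, real_roots a v -> ev phi v != 0) -> chamber a w ->
  exists w', [/\ chamber a w',
    forall v i, i \notin J -> coord w' v i 0 = coord w v i 0,
    forall v, real_roots a v -> 0 < ev phi v -> nonneg_on w v -> nonneg_on w' v,
    forall j, j \in J -> 0 < ev phi (w' *m simple_root j) &
    w' = w \/ (dist phi w' s < dist phi w s)%N].
Proof.
move=> hR hs hphi; have [k] := ubnP (dist phi w s).
elim: k w => // k IH w /ltnSE wk hw.
have [hJ|] := boolP [forall (j | j \in J), 0 < ev phi (w *m simple_root j)].
  by exists w; split=> // [j jJ|]; [move/forall_inP: hJ; apply | left].
rewrite negb_forall_in => /exists_inP[j jJ]; rewrite -leNgt => hj.
have {}hj : ev phi (w *m simple_root j) < 0.
  by rewrite lt_neqAle hj hphi //; apply: chamber_root.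
have [w1 [hw1 ww1 pos1 d1]] := reflect_closer hR hs hw hj.
have [w' [hw' ww' pos' hJ d']] := IH w1 (leq_trans d1 wk) hw1.
exists w'; split => //.
- by move=> v i iJ; rewrite ww' // ww1 //; apply: contraNneq iJ => ->.
- by move=> v rv fv hv; apply: pos' => //; apply: pos1.
- by right; case: d' => [->|/ltn_trans]; [| apply].
Qed.

(** Lexicographic order by [phi], then [psi]: take [N *: phi + psi] with [N] above all values of
    [psi] in absolute value on the finitely many roots. *)
Lemma lex_functional a phi psi : finite_set (real_roots a) -> exists chi : 'rV[int]_n,
  forall v, real_roots a v ->
    [/\ 0 < ev phi v -> 0 < ev chi v, ev phi v < 0 -> ev chi v < 0 &
        ev phi v = 0 -> ev chi v = ev psi v].
Proof.
move=> /finite_seqP[s hs].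
have [N hN] : exists N : int, forall v, v \in s -> `|ev psi v| < N.
  elim: s {hs} => [|u s [N hN]]; first by exists 0.
  exists (`|ev psi u| + 1 + `|N|) => v; rewrite inE => /orP[/eqP->|/hN]; lia.
exists (N *: phi + psi) => v; rewrite hs /= => /hN; rewrite evDl evZl.
by move: (ev phi v) (ev psi v) => x y h; split; nia.
Qed.

Lemma positive_chamber a phi : is_finite_root_system (@real_roots n C) ->
  (forall v, real_roots a v -> ev phi v != 0) ->
  exists2 w, chamber a w & forall j, 0 < ev phi (w *m simple_root j).
Proof.
move=> [hR /(_ a)/finite_seqP[s hs]] hphi.
have h1 : chamber a 1%:M by exists a; exact: weyl_hom_id.
have [w [hw _ _ hJ _]] := residue_chamber [set: 'I_n]%SET hR hs hphi h1.
by exists w => // j; apply: hJ; rewrite inE.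
Qed.

End Chambers.

(** * Bases of the rank three lattice and their dual functionals *)

Definition dual_bases (u1 u2 u3 : 'cV[int]_3) (g1 g2 g3 : 'rV[int]_3) : Prop :=
  (forall v, v = ev g1 v *: u1 + ev g2 v *: u2 + ev g3 v *: u3) /\
  (forall x y z, let v := x *: u1 + y *: u2 + z *: u3 in
     [/\ ev g1 v = x, ev g2 v = y & ev g3 v = z]).

Lemma dual_bases_swap12 u1 u2 u3 g1 g2 g3 :
  dual_bases u1 u2 u3 g1 g2 g3 -> dual_bases u2 u1 u3 g2 g1 g3.
Proof.
move=> [h1 h2]; split=> [v|x y z v]; first by rewrite [X in X + _]addrC -h1.
by rewrite /v [X in X + _]addrC; have [-> -> ->] := h2 y x z.
Qed.

(** The determinant is 1 or -1, hence its own inverse, and the rows of the inverse matrix are the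
    dual functionals. *)
Lemma vol3_dual_bases u1 u2 u3 : vol3 u1 u2 u3 = 1 ->
  exists g1 g2 g3, dual_bases u1 u2 u3 g1 g2 g3.
Proof.
rewrite /vol3; set M := (\matrix_(_, _) _) => hM.
have hu : M \in unitmx.
  by rewrite unitmxE; apply/unitrPr; exists (\det M); move: hM; move: (\det M) => d; nia.
have Mc x : M *m x = x ord0 0 *: u1 + x 1 0 *: u2 + x 2%:R 0 *: u3.
  apply/matrixP => k l; rewrite (ord1 l) !mxE !big_ord_recl big_ord0 !mxE addr0 addrA.
  rewrite !(tnth_nth 0) /= ![_ * x _ _]mulrC.
  by congr (x _ _ * _ + x _ _ * _ + x _ _ * _); apply/val_inj.
have Ec k v : ev (row k (invmx M)) v = (invmx M *m v) k 0.
  by rewrite /ev -row_mul mxE.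
exists (row ord0 (invmx M)), (row 1 (invmx M)), (row 2%:R (invmx M)); split=> [v|x y z v].
  by rewrite !Ec -Mc mulKVmx.
have -> : v = M *m \col_k [:: x; y; z]`_k by rewrite Mc !mxE.
by rewrite !Ec !mulKmx // !mxE.
Qed.

Section RankThree.
Context {C : cartan_scheme 3} {a : C}.
Hypothesis hC : is_finite_root_system (@real_roots 3 C).

(** * Root strings without gaps *)

Section Strings.
Context {u1 u2 u3 : 'cV[int]_3} {g1 g2 g3 : 'rV[int]_3}.
Hypothesis hg : dual_bases u1 u2 u3 g1 g2 g3.

Lemma dual1 : [/\ ev g1 u1 = 1, ev g2 u1 = 0 & ev g3 u1 = 0].
Proof. by have := hg.2 1 0 0; rewrite /= scale1r !scale0r !addr0. Qed.

Lemma dual2 : [/\ ev g1 u2 = 0, ev g2 u2 = 1 & ev g3 u2 = 0].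
Proof. by have := hg.2 0 1 0; rewrite /= scale1r !scale0r addr0 add0r. Qed.

Lemma dual3 : [/\ ev g1 u3 = 0, ev g2 u3 = 0 & ev g3 u3 = 1].
Proof. by have := hg.2 0 0 1; rewrite /= scale1r !scale0r !add0r. Qed.

(** A root killed by [phi] has [g2 = 0] and [g1 = - g3], so it is a multiple of [u3 - u1]; by
    primitivity it is [u3 - u1] up to sign. *)
Lemma nonvanishing_lex phi : ~ real_roots a (u3 - u1) ->
  (forall v, real_roots a v ->
    [/\ 0 < ev g2 v -> 0 < ev phi v, ev g2 v < 0 -> ev phi v < 0 &
        ev g2 v = 0 -> ev phi v = ev (g1 + g3) v]) ->
  forall v, real_roots a v -> ev phi v != 0.
Proof.
move=> hno hphi v rv; have [hp hn h0] := hphi v rv.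
have [] := ltrgtP 0 (ev g2 v) => [/hp|/hn|/esym g2v].
- by move=> /lt0r_neq0.
- by move=> /ltr0_neq0.
rewrite h0 // evDl; apply/eqP => e; apply: hno.
have {}e : ev g1 v = - ev g3 v by lia.
have ve : v = ev g3 v *: (u3 - u1).
  by rewrite {1}(hg.1 v) g2v e scale0r addr0 scaleNr scalerBr addrC.
have := rv; rewrite ve; case: (root_scale_unit rv ve) => ->.
  by rewrite scale1r.
by rewrite scaleN1r => /(real_rootN hC.1); rewrite opprK.
Qed.

(* If [u3 - u1] were not a root, [g1 + g3] would vanish at no root of the plane
   of [u1] and [u3], making both walls of one chamber; but [m *: u1 - u3] has
   mixed signs there. *)
Lemma root_string m : real_roots a u1 -> real_roots a u3 ->
  real_roots a (u3 - m *: u1) -> 1 <= m -> real_roots a (u3 - u1).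
Proof.
move=> r1 r3 rm m1; apply: contrapT => hno.
have [phi hphi] := lex_functional g2 (g1 + g3) (hC.2 a).
have nz := nonvanishing_lex hno hphi.
have [w hw pw] := positive_chamber hC nz.
have [e11 e21 e31] := dual1; have [e13 e23 e33] := dual3.
have [i u1i] : exists i, u1 = w *m simple_root i.
  apply: (ev1_column hC.1 hw r1 pw); have [_ _ ->] := hphi _ r1 => //.
  by rewrite evDl e11 e31.
have [k u3k] : exists k, u3 = w *m simple_root k.
  apply: (ev1_column hC.1 hw r3 pw); have [_ _ ->] := hphi _ r3 => //.
  by rewrite evDl e13 e33.
have ik : i != k.
  by apply/eqP => ik; move: e11; rewrite u1i ik -u3k e13.
have cm : coord w (u3 - m *: u1) = simple_root k - m *: simple_root i.
  by rewrite coordD coordN coordZ u1i u3k !coord_simple // (chamber_unitmx hw).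
case: (coord_root hC.1 hw rm) => /forallP h.
  by have := h i; rewrite cm !mxE !eqxx (negPf ik) /= mulr1; lia.
by have := h k; rewrite coordN cm !mxE !eqxx eq_sym (negPf ik) /= mulr0 subr0; lia.
Qed.

End Strings.

(** * The walk that keeps [u3] as a wall *)

Section Base.
Context {u1 u2 u3 : 'cV[int]_3} {g1 g2 g3 : 'rV[int]_3} {phi : 'rV[int]_3}.
Hypothesis hg : dual_bases u1 u2 u3 g1 g2 g3.
Hypotheses (r1 : real_roots a u1) (r2 : real_roots a u2) (r3 : real_roots a u3).
Hypothesis hplane : forall v, real_roots a v -> ev g3 v = 0 ->
  (0 <= ev g1 v) && (0 <= ev g2 v) || (ev g1 v <= 0) && (ev g2 v <= 0).
Hypotheses (no1 : ~ real_roots a (u3 - u1)) (no2 : ~ real_roots a (u3 - u2)).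
Hypothesis hphi : forall v, real_roots a v ->
  [/\ 0 < ev g3 v -> 0 < ev phi v, ev g3 v < 0 -> ev phi v < 0 &
      ev g3 v = 0 -> ev phi v = ev (g1 + g2) v].

(** In the plane [g3 = 0], [g1] and [g2] never have opposite signs on a root, so their sum vanishes
    only if both do. *)
Lemma phi_neq0 v : real_roots a v -> ev phi v != 0.
Proof.
move=> rv; have [hp hn h0] := hphi rv.
have [] := ltrgtP 0 (ev g3 v) => [/hp|/hn|/esym g3v].
- by move=> /lt0r_neq0.
- by move=> /ltr0_neq0.
rewrite h0 // evDl; apply/eqP => e; have := hplane rv g3v => h.
have [e1 e2] : ev g1 v = 0 /\ ev g2 v = 0 by lia.
have /eqP := real_root_neq0 rv; apply.
by rewrite (hg.1 v) e1 e2 g3v !scale0r !addr0.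
Qed.

(** If [p] is [u1] or [u2], [root_string] contradicts [no1] or [no2]. Otherwise [p] is a positive
    combination of both, so coordinate [i] vanishes on [u1] and [u2] as well as on [u3], yet it is 1
    on wall root [i]. *)
Lemma no_level0_summand p m w i : real_roots a p -> ev g3 p = 0 -> 0 < ev phi p ->
  real_roots a (u3 - m *: p) -> 1 <= m -> chamber a w ->
  coord w p i 0 = 0 -> coord w u3 i 0 = 0 ->
  nonneg_on w u1 -> nonneg_on w u2 -> False.
Proof.
move=> rp g3p fp rm m1 hw pi0 u3i /forallP/(_ i) h1 /forallP/(_ i) h2.
have pe : p = ev g1 p *: u1 + ev g2 p *: u2.
  by rewrite {1}(hg.1 p) g3p scale0r addr0.
have [_ _ fp0] := hphi rp; have {}fp0 := fp0 g3p; rewrite evDl in fp0.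
have hp := hplane rp g3p.
have [x0|x0] := eqVneq (ev g1 p) 0.
  rewrite x0 scale0r add0r in pe.
  have p2 : p = u2.
    by rewrite pe; case: (root_scale_unit rp pe) => e; rewrite e ?scale1r //; lia.
  by apply: no2; apply: (root_string (dual_bases_swap12 hg) r2 r3 (m := m)); rewrite -?p2.
have [y0|y0] := eqVneq (ev g2 p) 0.
  rewrite y0 scale0r addr0 in pe.
  have p1 : p = u1.
    by rewrite pe; case: (root_scale_unit rp pe) => e; rewrite e ?scale1r //; lia.
  by apply: no1; apply: (root_string hg r1 r3 (m := m)); rewrite -?p1.
have e : ev g1 p * coord w u1 i 0 + ev g2 p * coord w u2 i 0 = 0.
  by rewrite -[RHS]pi0 [in RHS]pe coordDE !coordZE.
have [u1i u2i] : coord w u1 i 0 = 0 /\ coord w u2 i 0 = 0.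
  move: e h1 h2 fp hp x0 y0; rewrite fp0.
  by move: (ev g1 p) (ev g2 p) (coord _ _ _ _) (coord _ _ _ _) => x y c d; nia.
have /matrixP/(_ i 0) := coord_simple i (chamber_unitmx hw).
rewrite (hg.1 (w *m _)) !coordDE !coordZE u1i u2i u3i !mulr0 !addr0 mxE !eqxx.
by [].
Qed.

Lemma common_chamber : exists w, chamber a w /\ exists i1 i2 i3,
  [/\ u1 = w *m simple_root i1, u2 = w *m simple_root i2 & u3 = w *m simple_root i3].
Proof.
have /finite_seqP[s hs] := hC.2 a.
have [e11 e21 e31] := dual1 hg; have [e12 e22 e32] := dual2 hg.
have [e13 e23 e33] := dual3 hg.
have f1 : ev phi u1 = 1 by have [_ _ ->] := hphi r1 => //; rewrite evDl e11 e21.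
have f2 : ev phi u2 = 1 by have [_ _ ->] := hphi r2 => //; rewrite evDl e12 e22.
have f3 : 0 < ev phi u3 by have [h _ _] := hphi r3; apply: h; rewrite e33.
have [w [hw [i3 u3i3] n1 n2]] : exists w, [/\ chamber a w,
    exists i3, u3 = w *m simple_root i3, nonneg_on w u1 & nonneg_on w u2].
  (* Starting chamber: ordering by [g1] first gives [u3] the value 1, which makes it a wall, and
     keeps [u1] and [u2] positive. *)
  have [psi hpsi] := lex_functional g1 (g2 + g3) (hC.2 a).
  have nz := nonvanishing_lex (dual_bases_swap12 hg) no2 hpsi.
  have [w hw pw] := positive_chamber hC nz.
  have p1 : 0 < ev psi u1 by have [h _ _] := hpsi _ r1; apply: h; rewrite e11.
  have p2 : ev psi u2 = 1 by have [_ _ ->] := hpsi _ r2 => //; rewrite evDl e22 e32.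
  have p3 : ev psi u3 = 1 by have [_ _ ->] := hpsi _ r3 => //; rewrite evDl e23 e33.
  exists w; split => //.
  - exact: (ev1_column hC.1 hw r3 pw p3).
  - exact: (root_nonneg_on hC.1 hw r1 pw p1).
  - by apply: (root_nonneg_on hC.1 hw r2 pw); rewrite p2.
(* The induction keeps three invariants: [u3] is a wall, and [u1] and [u2] are nonnegative on the
   chamber. *)
have [k] := ubnP (dist phi w s); elim: k w hw i3 u3i3 n1 n2 => // k IH w hw i3 u3i3 n1 n2.
move=> /ltnSE wk.
have [/forallP pw|] := boolP [forall j, 0 < ev phi (w *m simple_root j)].
  have [i1 u1i1] := ev1_column hC.1 hw r1 pw f1.
  have [i2 u2i2] := ev1_column hC.1 hw r2 pw f2.
  by exists w; split=> //; exists i1, i2, i3.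
rewrite negb_forall => /existsP[j /negP hj].
(* Move inside the rank two residue of [u3] and the bad wall [j]. The case [w' = w] is impossible,
   since [phi] is positive on wall [j] of [w']. *)
have [w' [hw' ww' pos' hJ [weq|d']]] :=
  residue_chamber [set i3; j]%SET hC.1 hs phi_neq0 hw.
  by case: hj; rewrite -weq; apply: hJ; rewrite !inE eqxx orbT.
have ji : j != i3 by apply/eqP => ji; apply: hj; rewrite ji -u3i3.
have {}n1 : nonneg_on w' u1 by apply: pos' => //; rewrite f1.
have {}n2 : nonneg_on w' u2 by apply: pos' => //; rewrite f2.
have n3 : nonneg_on w' u3.
  apply: pos' => //; rewrite u3i3; apply/forallP => l.
  by rewrite coord_simple ?(chamber_unitmx hw) // mxE; case: (_ && _).
set p := w' *m simple_root i3; set q := w' *m simple_root j.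
have fp : 0 < ev phi p by apply: hJ; rewrite !inE eqxx.
have fq : 0 < ev phi q by apply: hJ; rewrite !inE eqxx orbT.
have hu' := chamber_unitmx hw'.
have out l : l != i3 -> l != j -> coord w' u3 l 0 = 0.
  move=> l3 lj; rewrite ww' ?inE ?negb_or ?l3 //.
  by rewrite u3i3 coord_simple ?(chamber_unitmx hw) // !mxE (negPf l3).
have [m [n [m0 n0 u3pq]]] : exists m n, [/\ 0 <= m, 0 <= n & u3 = m *: p + n *: q].
  exists (coord w' u3 i3 0), (coord w' u3 j 0); split; try by move/forallP: n3; apply.
  rewrite {1}(coordE u3 hu') (bigD1 i3) //= (bigD1 j) //= big1 ?addr0 // => l.
  by move=> /andP[l3 lj]; rewrite out // scale0r.
have rp : real_roots a p := chamber_root i3 hw'.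
have rq : real_roots a q := chamber_root j hw'.
have level r : real_roots a r -> 0 < ev phi r -> 0 <= ev g3 r.
  by move=> rr; rewrite leNgt => fr; apply/negP => /(let: And3 _ h _ := hphi rr in h); lia.
have gp := level _ rp fp; have gq := level _ rq fq.
have gpq : m * ev g3 p + n * ev g3 q = 1 by rewrite -!evZ -evD -u3pq.
have close i : u3 = w' *m simple_root i -> exists w, chamber a w /\ exists i1 i2 i3,
    [/\ u1 = w *m simple_root i1, u2 = w *m simple_root i2 & u3 = w *m simple_root i3].
  by move=> u3i; apply: (IH w' hw' i) => //; apply: leq_trans d' wk.
(* If one coefficient vanishes, primitivity makes the other 1, so [u3] is still a wall and the
   induction hypothesis applies. *)
have [m00|m1] := eqVneq m 0.
  apply: (close j); rewrite m00 scale0r add0r in u3pq.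
  have n1' : n = 1 by case: (root_scale_unit r3 u3pq); lia.
  by rewrite u3pq n1' scale1r.
have [n00|n1'] := eqVneq n 0.
  apply: (close i3); rewrite n00 scale0r addr0 in u3pq.
  have m1' : m = 1 by case: (root_scale_unit r3 u3pq); lia.
  by rewrite u3pq m1' scale1r.
(* The third index [l] gives a coordinate vanishing on [p], [q] and [u3], as [no_level0_summand]
   requires. *)
have /card_gt0P[l] : (0 < #|~: [set i3; j]|)%N.
  by rewrite cardsCs finset.setCK card_ord cards2; case: (_ != _).
rewrite !inE negb_or => /andP[li lj].
have pl : coord w' p l 0 = 0 by rewrite coord_simple // !mxE (negPf li).
have ql : coord w' q l 0 = 0 by rewrite coord_simple // !mxE (negPf lj).
(* In [gpq] two nonnegative integers add up to 1: one is 0, and the other is a product equal to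
   1. *)
have mn : (ev g3 p = 0 /\ n = 1 \/ ev g3 q = 0 /\ m = 1).
  move: m0 n0 m1 n1' gp gq gpq; move: (ev g3 p) (ev g3 q) => x y m0 n0 m1 n1' x0 y0 e.
  have [x00|x1] : x = 0 \/ 1 <= x by lia.
    left; split=> //; rewrite x00 mulr0 add0r in e.
    have [y00|y1] : y = 0 \/ 1 <= y by lia.
      by rewrite y00 mulr0 in e.
    by nia.
  right; have mx : m <= m * x by nia.
  have ny : y <= n * y by nia.
  by split; lia.
case: mn => -[g0 e1].
- case: (@no_level0_summand p m w' l) => //; try lia.
    by have -> : u3 - m *: p = q by rewrite u3pq e1 scale1r addrC addKr.
  exact: out.
- case: (@no_level0_summand q n w' l) => //; try lia.
    by have -> : u3 - n *: q = p by rewrite u3pq e1 scale1r addrK.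
  exact: out.
Qed.

End Base.
End RankThree.

(** * Translation between bases and signs of the dual functionals *)

Lemma base_coord_signs (C : cartan_scheme 3) (a : C) u1 u2 u3 g1 g2 g3 v :
  dual_bases u1 u2 u3 g1 g2 g3 -> is_base a (saturated_span [tuple u1; u2]) [tuple u1; u2] ->
  real_roots a v -> ev g3 v = 0 ->
  (0 <= ev g1 v) && (0 <= ev g2 v) || (ev g1 v <= 0) && (ev g2 v <= 0).
Proof.
move=> hg [_ hb] rv g3v.
have sv : saturated_span [tuple u1; u2] v.
  exists (fun k => (if k == 0 then ev g1 v else ev g2 v)%:~R).
  rewrite {1}(hg.1 v) g3v scale0r addr0 map_mxD !map_mxZ.
  by rewrite !big_ord_recl big_ord0 addr0 !(tnth_nth 0).
(* The functionals [g1] and [g2] read off the natural coefficients supplied by the base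
   hypothesis. *)
have ev_nat (c : 'I_2 -> nat) : let x := \sum_(i < 2) tnth [tuple u1; u2] i *+ c i in
    (0 <= ev g1 x) && (0 <= ev g2 x).
  rewrite !big_ord_recl big_ord0 addr0 !(tnth_nth 0) /= -!scaler_nat.
  have := hg.2 (c ord0)%:R (c (lift ord0 ord0))%:R 0; rewrite scale0r addr0 /=.
  by move=> [-> -> _]; rewrite !ler0n.
have [[c ->]|[x [c ->] <-]] := hb v (conj sv rv); first by rewrite ev_nat.
by rewrite !evN !oppr_le0 ev_nat orbT.
Qed.

Lemma base_of_signs (C : cartan_scheme 3) (a : C) u1 u2 u3 g1 g2 g3 :
  dual_bases u1 u2 u3 g1 g2 g3 ->
  (forall v, real_roots a v ->
     [&& 0 <= ev g1 v, 0 <= ev g2 v & 0 <= ev g3 v] ||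
     [&& ev g1 v <= 0, ev g2 v <= 0 & ev g3 v <= 0]) ->
  is_base a [set: 'cV[int]_3] [tuple u1; u2; u3].
Proof.
move=> hg hs; split=> // v [_ rv].
have nat v' : [&& 0 <= ev g1 v', 0 <= ev g2 v' & 0 <= ev g3 v'] ->
    nat_span [tuple u1; u2; u3] v'.
  move=> /and3P[h1 h2 h3].
  exists (fun i => nth 0%N [:: `|ev g1 v'|%N; `|ev g2 v'|%N; `|ev g3 v'|%N] i).
  rewrite !big_ord_recl big_ord0 addr0 !(tnth_nth 0) /= addrA -!scaler_nat !natz.
  by rewrite !gez0_abs // -(hg.1 v').
case/orP: (hs v rv) => h; [left; exact: nat | right].
by exists (- v); [apply: nat; rewrite !evN !oppr_ge0 | rewrite opprK].
Qed.

Theorem corollary3p11 (C : cartan_scheme 3)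
    (hC : is_finite_irreducible_root_system (@real_roots 3 C))
    (a : C) (gamma1 gamma2 alpha : 'cV[int]_3)
    (hgamma1 : real_roots a gamma1) (hgamma2 : real_roots a gamma2)
    (halpha : real_roots a alpha)
    (hbase : is_base a (saturated_span [tuple gamma1; gamma2]) [tuple gamma1; gamma2])
    (hvol : vol3 gamma1 gamma2 alpha = 1) :
  is_base a [set: 'cV[int]_3] [tuple gamma1; gamma2; alpha] \/
  (real_roots a (alpha - gamma1) \/ real_roots a (alpha - gamma2)).
Proof.
have [r1|no1] := pselect (real_roots a (alpha - gamma1)); first by right; left.
have [r2|no2] := pselect (real_roots a (alpha - gamma2)); first by right; right.
left; have [hfin _] := hC.
have [g1 [g2 [g3 hg]]] := vol3_dual_bases hvol.
have [phi hphi] := lex_functional g3 (g1 + g2) (hfin.2 a).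
have hplane v := @base_coord_signs _ _ _ _ _ _ _ _ v hg hbase.
have [w [hw [i1 [i2 [i3 [e1 e2 e3]]]]]] :=
  common_chamber hfin hg hgamma1 hgamma2 halpha hplane no1 no2 hphi.
apply: (base_of_signs hg) => v rv; have hu := chamber_unitmx hw.
have [d11 d21 d31] := dual1 hg; have [d12 d22 d32] := dual2 hg.
have i12 : i1 != i2 by apply/eqP => i12; move: d11; rewrite e1 i12 -e2 d12.
have i13 : i1 != i3.
  by apply/eqP => i13; move: d31; rewrite e1 i13 -e3; have [_ _ ->] := dual3 hg.
have i23 : i2 != i3.
  by apply/eqP => i23; move: d32; rewrite e2 i23 -e3; have [_ _ ->] := dual3 hg.
(* Up to a permutation of indices, the chamber coordinates are the values of [g1], [g2], [g3], so
   [coord_root] yields the signs needed for a base. *)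
have cv i : coord w v i 0 =
    ev g1 v * (i == i1)%:R + ev g2 v * (i == i2)%:R + ev g3 v * (i == i3)%:R.
  rewrite {1}(hg.1 v) !coordDE !coordZE e1 e2 e3 !coord_simple //.
  by rewrite /simple_root !mxE !andbT.
have [c1 c2 c3] : [/\ coord w v i1 0 = ev g1 v, coord w v i2 0 = ev g2 v &
    coord w v i3 0 = ev g3 v].
  rewrite !cv !eqxx (negPf i12) (negPf i13) (negPf i23).
  rewrite !(eq_sym _ i1) (negPf i12) (negPf i13) eq_sym (negPf i23).
  by split; rewrite ?mulr0 ?mulr1 ?addr0 ?add0r.
rewrite -c1 -c2 -c3; case: (coord_root hfin.1 hw rv) => /forallP h; apply/orP.
  by left; rewrite !h.
right; have {}h i : coord w v i 0 <= 0.
  by have := h i; rewrite coordN mxE oppr_ge0.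
by rewrite !h.
Qed.
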